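(* Let $G$ be a graph on $n$ vertices that has exactly one dominating vertex, and suppose that this dominating vertex is also a cut vertex of $G$. Let $\lambda_n$ denote the largest eigenvalue of the Laplacian matrix $L(G)$. Then $\lambda_n$ is a simple eigenvalue, and an eigenvector $f_{\lambda_n}$ corresponding to $\lambda_n$ satisfies $\mathcal{D}(f_{\lambda_n})\ge 3$.
   Context: All graphs are finite, simple and undirected. The Laplacian matrix of a graph is $L=D-A$, where $A$ is the adjacency matrix and $D$ the diagonal matrix of vertex degrees. A vertex is dominating if it is adjacent to every other vertex of the graph. A vertex $v$ of a connected graph $G$ is a cut vertex if the induced graph obtained by deleting $v$ is disconnected. Strong nodal domains: for a vector $g$ on $V(G)$ with no zero entry, a strong nodal domain of $g$ is a maximal connected subgraph $H$ of $G$ such that $g(i)g(j)>0$ for all $i,j\in V(H)$; equivalently, a connected component of the subgraph induced on $\{g>0\}$ or on $\{g<0\}$. Number of nodal decomposition $\mathcal{D}(f)$: for an eigenvector $f$ of $L(G)$, $\mathcal{D}(f)$ is the minimum, over all vectors $g$ with $g(v)=f(v)$ whenever $f(v)\ne 0$ and $g(v)\in\{-1,1\}$ whenever $f(v)=0$, of the number of strong nodal domains of $g$. Since $\lambda_n$ is simple, $f_{\lambda_n}$ is unique up to a nonzero scalar, and $\mathcal{D}(f_{\lambda_n})\ge 3$ is asserted for any such eigenvector. *)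

(* Defs.v *)
From mathcomp Require Import all_boot all_order all_algebra.

Set Implicit Arguments.
Unset Strict Implicit.
Unset Printing Implicit Defensive.

Import Order.TTheory GRing.Theory Num.Theory.
Local Open Scope ring_scope.

(* A finite simple graph is a relation on 'I_n assumed symmetric and
   irreflexive; sets of vertices stand for the induced subgraphs. *)

(* The empty set of vertices counts as connected, so that deleting the only
   vertex of the one-vertex graph does not disconnect it. *)
Definition connected_on (V : finType) (e : rel V) (S : {set V}) : bool :=
  [forall x in S, forall y in S,
     connect [rel a b | [&& a \in S, b \in S & e a b]] x y].

Definition dominating (V : finType) (e : rel V) (v : V) : bool :=
  [forall w, (w != v) ==> e v w].

Definition cut_vertex (V : finType) (e : rel V) (v : V) : bool :=
  connected_on e [set: V] && ~~ connected_on e [set~ v].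

Definition degree (V : finType) (e : rel V) (v : V) : nat :=
  #|[set w | e v w]|.

Definition adjacency (R : pzRingType) (n : nat) (e : rel 'I_n) : 'M[R]_n :=
  \matrix_(i, j) (e i j)%:R.

Definition laplacian (R : pzRingType) (n : nat) (e : rel 'I_n) : 'M[R]_n :=
  diag_mx (\row_v (degree e v)%:R) - adjacency R e.

Definition largest_eigenvalue (R : realFieldType) (n : nat) (M : 'M[R]_n)
    (a : R) : Prop :=
  eigenvalue M a /\ forall b : R, eigenvalue M b -> b <= a.

(* Algebraic multiplicity one. *)
Definition simple_eigenvalue (R : fieldType) (n : nat) (M : 'M[R]_n)
    (a : R) : Prop :=
  mup a (char_poly M) = 1%N.

(* Like eigenspace, this uses row vectors; for a symmetric matrix these are the
   transposes of the usual column eigenvectors. *)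
Definition eigenvector (R : fieldType) (n : nat) (M : 'M[R]_n) (a : R)
    (f : 'rV[R]_n) : Prop :=
  (f <= eigenspace M a)%MS /\ f != 0.

Definition strong_nodal_domain (R : realFieldType) (n : nat) (e : rel 'I_n)
    (g : 'rV[R]_n) (H : {set 'I_n}) : bool :=
  maxset (fun S : {set 'I_n} =>
            [&& S != set0, connected_on e S &
                [forall i in S, forall j in S, 0 < g 0 i * g 0 j]]) H.

Definition num_strong_nodal_domains (R : realFieldType) (n : nat)
    (e : rel 'I_n) (g : 'rV[R]_n) : nat :=
  #|[set H | strong_nodal_domain e g H]|.

Definition completes (R : realFieldType) (n : nat) (f g : 'rV[R]_n) : Prop :=
  forall v, (f 0 v != 0 -> g 0 v = f 0 v) /\
            (f 0 v = 0 -> g 0 v = -1 \/ g 0 v = 1).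

(* The vectors g such that [completes f g] are exactly the [completion f s]
   (lemma completesP), so the minimum ranges over a finite type. *)
Definition completion (R : realFieldType) (n : nat) (f : 'rV[R]_n)
    (s : {ffun 'I_n -> bool}) : 'rV[R]_n :=
  \row_v (if f 0 v == 0 then (if s v then -1 else 1) else f 0 v).

Definition nodal_decomposition (R : realFieldType) (n : nat) (e : rel 'I_n)
    (f : 'rV[R]_n) : nat :=
  let count s := num_strong_nodal_domains e (completion f s) in
  count [arg min_(s < [ffun=> false]) count s]%N.

Lemma completesP (R : realFieldType) (n : nat) (f g : 'rV[R]_n) :
  completes f g <-> exists s, g = completion f s.
Proof.
split=> [fg | [s ->] v].
  exists [ffun v => g 0 v == -1]; apply/rowP=> v; rewrite mxE ffunE.
  have [fnz fz] := fg v; case: eqP => [/fz | /eqP/fnz //].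
  by case: eqP => [-> // | ngv [/ngv | ->]].
rewrite mxE; split=> [/negPf-> // | ->]; rewrite eqxx.
by case: (s v); [left | right].
Qed.

Lemma nodal_decompositionP (R : realFieldType) (n : nat) (e : rel 'I_n)
    (f : 'rV[R]_n) :
  (exists2 g, completes f g
     & num_strong_nodal_domains e g = nodal_decomposition e f) /\
  (forall g, completes f g ->
     (nodal_decomposition e f <= num_strong_nodal_domains e g)%N).
Proof.
rewrite /nodal_decomposition; case: arg_minnP => // s _ smin; split.
  by exists (completion f s) => //; apply/completesP; exists s.
by move=> g /completesP[t ->]; apply: smin.
Qed.

(* Main.v *)
Require Import Defs.
From mathcomp Require Import all_boot all_order all_algebra.

Set Implicit Arguments.
Unset Strict Implicit.
Unset Printing Implicit Defensive.

Import Order.TTheory GRing.Theory Num.Theory.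
Local Open Scope ring_scope.

(** Write [n] for the number of vertices and let [f] be an eigenvector of the
Laplacian for [lam != 0].  Its entries sum to [0] (lemma [eigen_sum0]), so
[n * f w] is the sum of the differences [f w - f x] over all [x]; subtracting
the eigenvalue equation at [w] leaves only the non-neighbours of [w]:
[(n - lam) * f w = \sum_(x | ~~ e w x) (f w - f x)] (lemma [eigen_complement]).
Everything spectral follows from this identity by a maximum principle.

At a maximum of [f] the right-hand side is nonnegative; hence [lam > n] would
force [f <= 0], and then [f = 0].  So no eigenvalue exceeds [n].  Conversely, a
dominating vertex [v] makes [n] an eigenvalue, with eigenvector [1 - n * e_v]
([star_vector]), so the largest eigenvalue is [n].

For [lam = n] the identity says that [f] is harmonic on the complement graph:
where [f] is maximal off [v], it takes the same value at all non-neighbours.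
Since deleting [v] disconnects the graph, the other vertices split into two
nonempty parts without edges between them, so in the complement every vertex of
one part is joined to every vertex of the other, and [f] is constant off [v]
(lemma [eigen_n_const]).  The zero sum then makes [f] a multiple of
[1 - n * e_v], so the eigenspace is a line; for a symmetric matrix this gives
algebraic multiplicity one (lemma [symmetric_simple_eigenvalue]).

Finally [1 - n * e_v] has no zero entry, so there is nothing to complete, and
its sign at [v] is opposite to the sign elsewhere.  Its nodal domains are
therefore [{v}] and the components left after deleting [v], of which there are
at least two (lemma [three_nodal_domains]). *)

(** * Simple eigenvalues of symmetric matrices *)

Lemma mulmx_tr_gt0 (F : realFieldType) (n : nat) (u : 'rV[F]_n) :
  u != 0 -> 0 < (u *m u^T) 0 0.
Proof.
move=> u0; rewrite mxE lt0r; apply/andP; split; last first.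
  by apply: sumr_ge0 => i _; rewrite mxE -expr2 sqr_ge0.
apply: contraNneq u0 => s0; apply/eqP/rowP => i; rewrite mxE.
have /psumr_eq0P/(_ s0)/(_ i isT) : forall j : 'I_n, true -> 0 <= u 0 j * u^T j 0.
  by move=> j _; rewrite mxE -expr2 sqr_ge0.
by rewrite mxE => /eqP; rewrite mulf_eq0 orbb => /eqP.
Qed.

(** The size equation is a hypothesis, rather than [u] having length [k.+1], so
that [k] can be rewritten into the rank of the kernel, the height of [row_base],
without affecting the width [n]. *)
Lemma orthogonal_basis (F : fieldType) (n k : nat) (u : 'rV[F]_n) :
  u != 0 -> n = k.+1 ->
  exists2 W : 'M[F]_(k, n), row_free W & (W :=: kermx u^T)%MS.
Proof.
move=> u0 nk; have /esym rK : \rank (kermx u^T) = k.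
  by rewrite mxrank_ker mxrank_tr rank_rV u0 nk subn1.
rewrite rK; exists (row_base (kermx u^T)); first exact: row_base_free.
exact: eq_row_base.
Qed.

(** Over polynomials, [P *m ('X - A) = ('X - B) *m P]; the nonzero factor [\det P]
cancels from the determinants. *)
Lemma similar_char_poly (F : fieldType) (n : nat) (P A B : 'M[F]_n) :
  P \in unitmx -> P *m A = B *m P -> char_poly A = char_poly B.
Proof.
move=> Pu PA; have detP0 : \det (map_mx polyC P) != 0.
  by rewrite det_map_mx polyC_eq0 -unitfE.
apply: (mulfI detP0); rewrite /char_poly -det_mulmx [RHS]mulrC -det_mulmx.
rewrite /char_poly_mx mulmxBr mulmxBl.
by rewrite -!map_mxM PA scalar_mxC.
Qed.

(** In a basis made of [u] and a basis [W] of the orthogonal complement of [u],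
which [M] preserves by symmetry, [M] becomes block diagonal with blocks [a] and
[D].  A double root [a] would make [a] an eigenvalue of [D], which yields an
eigenvector of [M] orthogonal to [u], hence not a multiple of it. *)
Lemma symmetric_simple_eigenvalue (F : realFieldType) (m : nat)
    (M : 'M[F]_m.+1) (a : F) (u : 'rV[F]_m.+1) :
  M^T = M -> u != 0 -> u *m M = a *: u ->
  (forall w : 'rV_m.+1, w *m M = a *: w -> exists c, w = c *: u) ->
  simple_eigenvalue M a.
Proof.
move=> Msym u0 uM uniq.
have uu0 := mulmx_tr_gt0 u0.
have [W Wfree WK] := orthogonal_basis u0 (erefl m.+1).
have Wu : W *m u^T = 0 by apply/sub_kermxP; rewrite WK.
have Mu : M *m u^T = a *: u^T by rewrite -{1}Msym -trmx_mul uM linearZ.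
have /submxP[D WM] : (W *m M <= W)%MS.
  by rewrite WK; apply/sub_kermxP; rewrite -mulmxA Mu -scalemxAr Wu scaler0.
have ortho (c : F) (y : 'rV_m) : c *: u + y *m W = 0 -> c = 0.
  move=> /(congr1 (fun z => (z *m u^T) 0 0)).
  rewrite mulmxDl -mulmxA Wu mulmx0 addr0 -scalemxAl mul0mx mxE [RHS]mxE.
  by move/eqP; rewrite mulf_eq0 (gt_eqF uu0) orbF => /eqP.
pose P : 'M_(1 + m) := col_mx u W.
have Pu : P \in unitmx.
  rewrite -row_free_unit -kermx_eq0; apply/rowV0P => x /sub_kermxP.
  rewrite -[x]hsubmxK mul_row_col [lsubmx x]mx11_scalar mul_scalar_mx => x0.
  have c0 := ortho _ _ x0; move: x0; rewrite c0 scale0r add0r => yW.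
  suff -> : rsubmx x = 0 by rewrite raddf0 row_mx0.
  by apply: (row_free_inj Wfree); rewrite mul0mx.
have PM : P *m M = block_mx a%:M 0 0 D *m P.
  by rewrite mul_col_mx mul_block_col !mul0mx addr0 add0r mul_scalar_mx -WM uM.
rewrite /simple_eigenvalue (similar_char_poly Pu PM) /char_poly.
rewrite char_block_diag_mx det_ublock -!/(char_poly _) char_poly_trig.
  rewrite big_ord1 mxE eqxx mulr1n mupMl.
    by rewrite -['X - _]expr1 mup_XsubCX eqxx.
  rewrite -eigenvalue_root_char; apply/eigenvalueP => -[y yD y0].
  have /uniq[c cu] : (y *m W) *m M = a *: (y *m W).
    by rewrite -mulmxA WM mulmxA yD scalemxAl.
  have : - c *: u + y *m W = 0 by rewrite cu scaleNr addNr.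
  move/ortho/eqP; rewrite oppr_eq0 => /eqP c0.
  case/eqP: y0; apply: (row_free_inj Wfree).
  by rewrite cu c0 scale0r mul0mx.
by apply/is_trig_mxP => i j; rewrite !ord1.
Qed.

Lemma one_sub_natr (F : pzRingType) k :
  (0 < k)%N -> 1 - k%:R = - k.-1%:R :> F.
Proof. by move=> k0; rewrite -subn1 natrB // opprB. Qed.

(** * The largest Laplacian eigenvalue of a graph with a dominating vertex *)

Section Laplacian.
Variables (R : realFieldType) (n : nat) (e : rel 'I_n).
Hypotheses (e_sym : symmetric e) (e_irr : irreflexive e).

Lemma laplacian_sym : (laplacian R e)^T = laplacian R e.
Proof.
apply/matrixP=> i j; rewrite !mxE e_sym eq_sym.
by case: eqVneq => [-> //|]; rewrite !mulr0n.
Qed.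

Lemma mul_laplacian (f : 'rV[R]_n) w :
  (f *m laplacian R e) 0 w = \sum_(x | e w x) (f 0 w - f 0 x).
Proof.
rewrite mulmxBr mxE mul_mx_diag !mxE sumrB sumr_const mulr_natr.
congr (_ *+ _ - _); first by apply: eq_card => x; rewrite inE.
rewrite [RHS]big_mkcond; apply: eq_bigr => x _; rewrite mxE e_sym.
by case: (e w x); rewrite ?mulr1 ?mulr0.
Qed.

(** Each edge contributes opposite terms at its two ends, so the entries of
[f *m laplacian R e] sum to zero. *)
Lemma eigen_sum0 (f : 'rV[R]_n) lam : lam != 0 -> f *m laplacian R e = lam *: f ->
  \sum_x f 0 x = 0.
Proof.
move=> lam0 fL; apply: (mulfI lam0); rewrite mulr0 mulr_sumr.
transitivity (\sum_w (f *m laplacian R e) 0 w).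
  by rewrite fL; apply: eq_bigr => w _; rewrite mxE.
under eq_bigr do rewrite mul_laplacian big_mkcond.
set S := \sum_w _; suff : S = - S.
  by move/eqP; rewrite -addr_eq0 -mulr2n mulrn_eq0 => /eqP.
rewrite {1}/S exchange_big /= -sumrN; apply: eq_bigr => w _.
rewrite -sumrN; apply: eq_bigr => x _; rewrite e_sym.
by case: ifP; rewrite ?oppr0 ?opprB.
Qed.

(** Complementation turns the eigenvalue [lam] into [n - lam] on vectors of sum
zero: the right-hand side is the Laplacian of the complement graph applied to
[f], the term [x = w] being zero. *)
Lemma eigen_complement (f : 'rV[R]_n) lam w : lam != 0 -> f *m laplacian R e = lam *: f ->
  (n%:R - lam) * f 0 w = \sum_(x | ~~ e w x) (f 0 w - f 0 x).
Proof.
move=> lam0 fL; have s0 := eigen_sum0 lam0 fL.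
have := mul_laplacian f w; rewrite fL mxE mulrBl => ->.
have -> : n%:R * f 0 w = \sum_x (f 0 w - f 0 x).
  by rewrite sumrB s0 subr0 sumr_const card_ord mulr_natl.
by rewrite [in LHS](bigID (e w)) /= addrAC subrr add0r.
Qed.

(** If [n < lam], [eigen_complement] at a maximum of [f] shows that this maximum
is at most [0]; since the entries sum to zero, [f] vanishes. *)
Lemma laplacian_eigenvalue_le (f : 'rV[R]_n) lam : f != 0 ->
  f *m laplacian R e = lam *: f -> lam <= n%:R.
Proof.
move=> f0 fL; rewrite leNgt; apply/negP => ltn.
have lam0 : lam != 0 by rewrite gt_eqF // (le_lt_trans _ ltn) ?ler0n.
have s0 := eigen_sum0 lam0 fL.
have [i fi] : exists i, f 0 i != 0.
  apply/existsP; apply: contraNT f0 => /existsPn fz.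
  by apply/eqP/rowP => i; rewrite mxE; apply/eqP/negPn.
have f_le0 x : f 0 x <= 0.
  case: (@Order.TotalTheory.arg_maxP _ R 'I_n i xpredT (f 0) isT) => w _ wmax.
  apply: le_trans (wmax x isT) _.
  rewrite -(@nmulr_rge0 _ (n%:R - lam)) ?subr_lt0 //.
  rewrite (eigen_complement w lam0 fL) sumr_ge0 // => y _.
  by rewrite subr_ge0; apply: wmax.
case/eqP: fi; apply/eqP; rewrite -oppr_eq0; apply/eqP.
apply: (@psumr_eq0P R 'I_n xpredT (fun x => - f 0 x)) => //.
  by move=> x _; rewrite oppr_ge0.
by rewrite sumrN s0 oppr0.
Qed.

Lemma dominating_adj v x : dominating e v -> e v x = (x != v).
Proof.
move=> /forallP/(_ x)/implyP vd; apply/idP/idP => // vx.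
by apply: contraTneq vx => ->; rewrite e_irr.
Qed.

Definition star_vector (v : 'I_n) : 'rV[R]_n :=
  \row_x (1 - n%:R * (x == v)%:R).

Lemma star_vector_eigen v : dominating e v ->
  star_vector v *m laplacian R e = n%:R *: star_vector v.
Proof.
move=> vd; apply/rowP => w; rewrite mul_laplacian !mxE.
have n0 : (0 < n)%N := leq_ltn_trans (leq0n v) (ltn_ord v).
have [-> | wv] := eqVneq w v.
  transitivity (\sum_(x | x != v) - n%:R : R).
    apply: eq_big => [x | x]; first exact: dominating_adj.
    rewrite dominating_adj // !mxE => /negPf ->.
    by rewrite mulr0 mulr1 subr0 addrAC subrr sub0r.
  rewrite sumr_const cardC1 card_ord mulr1.
  by rewrite one_sub_natr // mulrN mulr_natr mulNrn.
rewrite (bigD1 v) /=; last by rewrite e_sym dominating_adj.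
rewrite !mxE eqxx big1 => [|x /andP[_ /negPf xv]].
  by rewrite addr0 mulr0 mulr1 !subr0 opprB addrC subrK mulr1.
by rewrite !mxE xv subrr.
Qed.

(** Maximum principle on the complement of the graph minus [v], which is
connected because it contains all pairs between [S] and the other vertices: the
set where [f] attains its maximum off [v] is closed under non-adjacency. *)
Lemma eigen_n_const (f : 'rV[R]_n) v x y (S : {set 'I_n}) : dominating e v ->
  f *m laplacian R e = n%:R *: f ->
  x \in S -> y \notin S -> x != v -> y != v ->
  (forall a b, a \in S -> b \notin S -> a != v -> b != v -> ~~ e a b) ->
  forall w, w != v -> f 0 w = f 0 x.
Proof.
move=> vd fL xS yS xv yv Scut.
have n0 : n%:R != 0 :> R.
  by rewrite pnatr_eq0 -lt0n (leq_ltn_trans (leq0n v) (ltn_ord v)).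
case: (@Order.TotalTheory.arg_maxP _ R 'I_n x (predC1 v) (f 0) xv) => m /= mv mmax.
(* The non-neighbours of a maximizer avoid [v], so the sum in
   [eigen_complement] has nonnegative terms and vanishes termwise. *)
have spread a b : a != v -> f 0 a = f 0 m -> ~~ e a b -> f 0 b = f 0 m.
  move=> av am ab; apply/esym/eqP; rewrite -subr_eq0 -am; apply/eqP.
  apply: (@psumr_eq0P R 'I_n (fun b => ~~ e a b) (fun b => f 0 a - f 0 b)) => //.
    move=> c ac; rewrite subr_ge0 am mmax //=.
    by apply: contraNneq ac => ->; rewrite e_sym dominating_adj.
  by rewrite -(eigen_complement a n0 fL) subrr mul0r.
have noedge_sym a b : a \in S -> b \notin S -> a != v -> b != v -> ~~ e b a.
  by rewrite e_sym; apply: Scut.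
have [fx fy] : f 0 x = f 0 m /\ f 0 y = f 0 m.
  have [mS | mS] := boolP (m \in S).
    have fy : f 0 y = f 0 m by apply: (spread m) => //; apply: Scut.
    by split=> //; apply: (spread y) => //; apply: noedge_sym.
  have fx : f 0 x = f 0 m by apply: (spread m) => //; apply: noedge_sym.
  by split=> //; apply: (spread x) => //; apply: Scut.
move=> w wv; rewrite fx; have [wS | wS] := boolP (w \in S).
  by apply: (spread y) => //; apply: noedge_sym.
by apply: (spread x) => //; apply: Scut.
Qed.

Lemma star_vectorP (f : 'rV[R]_n) v c : n != 0 -> \sum_x f 0 x = 0 ->
  (forall w, w != v -> f 0 w = c) -> f = c *: star_vector v.
Proof.
move=> n0 s0 fc; apply/rowP => w; rewrite !mxE.
have [-> | wv] := eqVneq w v; last by rewrite fc // mulr0 subr0 mulr1.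
move: s0; rewrite (bigD1 v) //= (eq_bigr (fun=> c)) // sumr_const cardC1 card_ord.
move/eqP; rewrite addr_eq0 => /eqP ->.
by rewrite mulr1 one_sub_natr ?lt0n // mulrN mulr_natr.
Qed.
End Laplacian.

(** * Nodal domains around a cut vertex *)

Lemma cut_vertex_split (V : finType) (e : rel V) v : cut_vertex e v ->
  exists x y, [/\ x != v, y != v &
    ~~ connect [rel a b | [&& a \in [set~ v], b \in [set~ v] & e a b]] x y].
Proof.
case/andP=> _ /forallPn[x]; rewrite negb_imply => /andP[xv].
case/forallPn=> y; rewrite negb_imply => /andP[yv xy].
by exists x, y; rewrite !inE in xv yv.
Qed.

Lemma connected_on1 (V : finType) (e : rel V) x : connected_on e [set x].
Proof.
apply/forallP => a; apply/implyP => /set1P ->.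
by apply/forallP => b; apply/implyP => /set1P ->; apply: connect0.
Qed.

(** Extend [v] and two vertices [x], [y] separated by deleting [v] to nodal
domains.  By signs, those of [x] and [y] avoid [v], so a common one would
connect [x] to [y] without passing through [v]. *)
Lemma three_nodal_domains (R : realFieldType) (n : nat) (e : rel 'I_n)
    (g : 'rV[R]_n) v :
  cut_vertex e v -> (forall w, g 0 w != 0) ->
  (forall w, w != v -> g 0 v * g 0 w < 0) ->
  (3 <= num_strong_nodal_domains e g)%N.
Proof.
move=> vcut g0 gv; have [x [y [xv yv xy]]] := cut_vertex_split vcut.
have domain z : exists2 H, strong_nodal_domain e g H & z \in H.
  have [|H Hmax] := @maxset_exists _ (fun S : {set 'I_n} =>
            [&& S != set0, connected_on e S &
                [forall i in S, forall j in S, 0 < g 0 i * g 0 j]]) [set z].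
    rewrite -card_gt0 cards1 connected_on1 /=.
    apply/forallP => a; apply/implyP => /set1P ->.
    apply/forallP => b; apply/implyP => /set1P ->.
    by rewrite -expr2 exprn_even_gt0 ?g0 ?orbT.
  by rewrite sub1set => zH; exists H.
have no_v H w : strong_nodal_domain e g H -> w \in H -> w != v -> v \notin H.
  move=> /maxsetp/and3P[_ _ /forallP sgn] wH wv; apply/negP => vH.
  have /forallP/(_ w) := implyP (sgn v) vH.
  by rewrite wH /= => /lt_trans/(_ (gv w wv)); rewrite ltxx.
have [A Adom vA] := domain v; have [B Bdom xB] := domain x.
have [C Cdom yC] := domain y.
have vB := no_v _ _ Bdom xB xv; have vC := no_v _ _ Cdom yC yv.
have AB : A != B by apply: contraTneq vA => ->.
have AC : A != C by apply: contraTneq vA => ->.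
have BC : B != C.
  apply: contraNneq xy => BC; rewrite -BC in yC.
  have /maxsetp/and3P[_ /forallP conn _] := Bdom.
  have /forallP/(_ y) := implyP (conn x) xB; rewrite yC /=.
  apply: connect_sub => a b /and3P[aB bB ab]; apply: connect1 => /=.
  by rewrite !inE ab andbT; apply/andP; split; apply: contraTneq vB => <-; rewrite negbK.
rewrite /num_strong_nodal_domains.
have <- : #|[set A; B; C]| = 3%N.
  by rewrite setUC cardsU1 cards2 !inE AB negb_or eq_sym AC eq_sym BC.
by apply/subset_leq_card/subsetP => H; rewrite !inE => /orP[/orP[]|] /eqP ->.
Qed.

Lemma completion_nonzero (R : realFieldType) (n : nat) (f : 'rV[R]_n) s :
  (forall w, f 0 w != 0) -> completion f s = f.
Proof. by move=> f0; apply/rowP => w; rewrite mxE (negPf (f0 w)). Qed.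

Theorem theorem2p12 (R : rcfType) (n : nat) (e : rel 'I_n)
    (e_sym : symmetric e) (e_irr : irreflexive e)
    (v : 'I_n) (v_dom : dominating e v)
    (v_uniq : forall w : 'I_n, dominating e w -> w = v)
    (v_cut : cut_vertex e v)
    (lam : R) (lam_max : largest_eigenvalue (laplacian R e) lam) :
  simple_eigenvalue (laplacian R e) lam /\
  forall f : 'rV[R]_n, eigenvector (laplacian R e) lam f ->
    (3 <= nodal_decomposition e f)%N.
Proof.
have [x [y [xv yv xy]]] := cut_vertex_split v_cut.
have n_gt1 : (1 < n)%N.
  by rewrite -[n]card_ord; apply/card_gt1P; exists x, v.
have n0 : n != 0%N by rewrite -lt0n ltnW.
have nR0 : n%:R != 0 :> R by rewrite pnatr_eq0.
have u_lt0 : 1 - n%:R < 0 :> R by rewrite subr_lt0 ltr1n.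
have u0 : star_vector R v != 0.
  apply/eqP => /rowP/(_ x); rewrite !mxE (negPf xv) mulr0 subr0.
  by apply/eqP; rewrite oner_eq0.
have uL := star_vector_eigen R e_sym e_irr v_dom.
have lamE : lam = n%:R.
  case: lam_max => /eigenvalueP[f fL f0] lam_max.
  apply/eqP; rewrite eq_le (laplacian_eigenvalue_le e_sym f0 fL) /=.
  by apply: lam_max; apply/eigenvalueP; exists (star_vector R v).
have eigen_star f : f *m laplacian R e = n%:R *: f ->
    exists c, f = c *: star_vector R v.
  move=> fL; exists (f 0 x); apply: star_vectorP => //.
    exact: eigen_sum0 nR0 fL.
  (* One side of the cut is the component of [x] in the graph minus [v]. *)
  apply: (eigen_n_const e_sym e_irr v_dom fL (y := y)
    (S := [set z | connect
      [rel a b | [&& a \in [set~ v], b \in [set~ v] & e a b]] x z])).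
  - by rewrite inE connect0.
  - by rewrite inE.
  - by [].
  - by [].
  move=> a b; rewrite !inE => xa xb av bv; apply: contraNN xb => ab.
  by apply: connect_trans xa (connect1 _); rewrite /= !inE av bv.
rewrite lamE; split.
  have := laplacian_sym R e_sym; move: u0 uL eigen_star.
  move: (star_vector R v) (laplacian R e).
  clear -n0; case: n n0 => // m _ u M u0 uL eigen_star M_sym.
  exact: symmetric_simple_eigenvalue M_sym u0 uL eigen_star.
move=> f [/eigenspaceP fL f0]; have [c fE] := eigen_star f fL.
have c0 : c != 0 by apply: contraNneq f0 => c0; rewrite fE c0 scale0r.
have fv : f 0 v = c * (1 - n%:R) by rewrite fE !mxE eqxx mulr1.
have fw w : w != v -> f 0 w = c.
  by move=> wv; rewrite fE !mxE (negPf wv) mulr0 subr0 mulr1.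
have f_neq0 w : f 0 w != 0.
  by have [-> | /fw -> //] := eqVneq w v; rewrite fv mulf_neq0 // lt_eqF.
rewrite /nodal_decomposition completion_nonzero //.
apply: (three_nodal_domains v_cut) => // w wv.
by rewrite fv fw // mulrAC pmulr_rlt0 // -expr2 exprn_even_gt0.
Qed.
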